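(* Let $\Gamma=\langle S|R\rangle$ be a Coxeter group with its standard Coxeter generating set $S$. The word metric on $\Gamma$ with respect to $S$ is conditionally strictly negative definite if and only if $\Gamma$ is a free Coxeter group, i.e. $\Gamma=\ast_{i=1}^n\mathbb{Z}/2\mathbb{Z}$ (all coefficients $m_{s,t}=\infty$). Let $\Gamma=\langle S|R\rangle$ be an Artin group with its standard generating set $S$. The word metric on $\Gamma$ with respect to $S$ is conditionally strictly negative definite if and only if $\Gamma$ is a free group, i.e. $\Gamma=\ast_{i=1}^n\mathbb{Z}$ (all coefficients $m_{s,t}=\infty$).
   Context: A hermitian kernel $K\colon X\times X\to\mathbb{C}$ is conditionally strictly negative definite if $\sum_{x,y\in X}\lambda(x)\overline{\lambda(y)}K(x,y)<0$ for every nonzero finitely supported $\lambda\colon X\to\mathbb{C}$ with $\sum_{x}\lambda(x)=0$. For a semigroup element pair $s,t$ and $k\in\mathbb{N}$, the alternating product $\langle s,t\rangle^k$ denotes the word $stst\ldots$ of length $k$ starting with $s$. Given a set $S$ and coefficients $m_{s,t}=m_{t,s}\in\{2,3,\ldots\}\cup\{\infty\}$ for $s\neq t\in S$, the Artin group is $\langle S\mid \langle s,t\rangle^{m_{s,t}}=\langle t,s\rangle^{m_{s,t}}\ (s\neq t)\rangle$, where $m_{s,t}=\infty$ means no such relation is imposed; the corresponding Coxeter group is its quotient by the normal subgroup generated by $\{s^2:s\in S\}$. The word metric is the path metric on the Cayley graph with respect to $S$. *)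

(* Defs.v *)
From HB Require Import structures.
From mathcomp Require Import all_boot all_order all_algebra.
From mathcomp Require Import complex.
From mathcomp Require Import Rstruct.
From Stdlib Require Import ClassicalEpsilon.
Set Implicit Arguments. Unset Strict Implicit. Unset Printing Implicit Defensive.
Import Order.TTheory GRing.Theory Num.Theory.
Local Open Scope ring_scope.

Definition Cx : Type := complex Rdefinitions.R.

(* Letters over a generating set S: (false, s) is s, (true, s) is s^-1. *)
Definition letter (S : finType) : Type := (bool * S)%type.
Definition word (S : finType) : Type := seq (letter S).

Definition winv (S : finType) (w : word S) : word S :=
  rev (map (fun l => (~~ l.1, l.2)) w).

Definition alt (S : finType) (s t : S) (k : nat) : word S :=
  mkseq (fun i => (false, if odd i then t else s)) k.

(* Coefficients m_{s,t}: None encodes infinity. *)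
Definition coxeter_matrix (S : finType) (m : S -> S -> option nat) : Prop :=
  (forall s t, m s t = m t s) /\
  (forall s t k, s != t -> m s t = Some k -> (2 <= k)%N).

Definition rels (S : finType) : Type := word S -> word S -> Prop.

Definition artin_rel (S : finType) (m : S -> S -> option nat) : rels S :=
  fun l r => exists s t k, s != t /\ m s t = Some k /\ l = alt s t k /\ r = alt t s k.

Definition coxeter_rel (S : finType) (m : S -> S -> option nat) : rels S :=
  fun l r => artin_rel m l r \/ exists s, l = [:: (false, s); (false, s)] /\ r = [::].

(* Equality in the group <S | R>: the congruence on words generated by
   free reduction and the relations R. *)
Inductive weq (S : finType) (R : rels S) : word S -> word S -> Prop :=
| weq_refl w : weq R w w
| weq_sym u v : weq R u v -> weq R v u
| weq_trans u v w : weq R u v -> weq R v w -> weq R u w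
| weq_free u v b s : weq R (u ++ [:: (b, s); (~~ b, s)] ++ v) (u ++ v)
| weq_rel u v l r : R l r -> weq R (u ++ l ++ v) (u ++ r ++ v).

Definition is_wordlen (S : finType) (R : rels S) (g : word S) (n : nat) : Prop :=
  (exists w, size w = n /\ weq R w g) /\ (forall w, weq R w g -> (n <= size w)%N).

Definition wordlen (S : finType) (R : rels S) (g : word S) : nat :=
  epsilon (inhabits 0%N) (is_wordlen R g).

Definition word_dist (S : finType) (R : rels S) (x y : word S) : nat :=
  wordlen R (winv x ++ y).

(* The word metric on <S | R> is conditionally strictly negative definite:
   for every nonzero finitely supported lambda (given by finitely many pairwise
   distinct group elements x_i with coefficients lambda_i) with sum zero,
   sum_{i,j} lambda_i conj(lambda_j) d(x_i, x_j) < 0. *)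
Definition word_metric_CSND (S : finType) (R : rels S) : Prop :=
  forall (n : nat) (x : 'I_n -> word S) (lam : 'I_n -> Cx),
    (forall i j, i != j -> ~ weq R (x i) (x j)) ->
    \sum_(i < n) lam i = 0 ->
    (exists i, lam i != 0) ->
    \sum_(i < n) \sum_(j < n) lam i * Num.conj (lam j) * (word_dist R (x i) (x j))%:R < 0.

Definition all_infinite (S : finType) (m : S -> S -> option nat) : Prop :=
  forall s t, s != t -> m s t = None.

(* Main.v *)
Require Import Defs.
From Stdlib Require Import Reals ClassicalEpsilon Classical.
From mathcomp Require Import all_boot all_order all_algebra.
From mathcomp Require Import complex Rstruct ring zify.

(** If all coefficients are infinite, the Cayley graph is a tree and elements are
    reduced words: [d x y = |x| + |y| - 2 lcp x y], where [lcp x y] counts the common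
    nonempty prefixes. For [\sum_i lam i = 0] the quadratic form is therefore
    [-2 \sum_p |\sum_(p prefix of x_i) lam i|^2], and the term where [p] is a longest
    word of the support is nonzero.

    If [m s t = k] is finite, the dihedral subgroup generated by [s] and [t] spans a
    [2k]-cycle of the Coxeter graph, and two pairs of antipodes with weights
    [+1, -1, +1, -1] give the value [0]; the same four positive words work in the
    Artin group, since the projection to the Coxeter group does not increase lengths.
    The only point to prove is that the alternating word of length [k] is geodesic in
    the Coxeter group: in the geometric representation, the parity of the number of
    times a word crosses a given root (up to sign) depends only on the group element,
    and the alternating word crosses [k] distinct roots exactly once. *)

Set Implicit Arguments. Unset Strict Implicit. Unset Printing Implicit Defensive.
Import Order.TTheory GRing.Theory Num.Theory.
Local Open Scope ring_scope.

(** * Words and word length *)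

Section Words.
Variables (S : finType) (R : rels S).
Implicit Types u v w x y : word S.

Lemma winv_cat u v : winv (u ++ v) = winv v ++ winv u.
Proof. by rewrite /winv map_cat rev_cat. Qed.

Lemma winvK : involutive (@winv S).
Proof.
move=> u; rewrite /winv map_rev revK -map_comp -[RHS]map_id.
by apply: eq_map => -[b s] /=; rewrite negbK.
Qed.

Lemma size_winv u : size (winv u) = size u.
Proof. by rewrite /winv size_rev size_map. Qed.

Lemma weq_ctx p q u v : weq R u v -> weq R (p ++ u ++ q) (p ++ v ++ q).
Proof.
elim=> {u v} [w|u v _ h|u v w _ h1 _ h2|u v b s|u v l r h].
- exact: weq_refl.
- exact: weq_sym.
- exact: weq_trans h1 h2.
- by have := weq_free R (p ++ u) (v ++ q) b s; rewrite /= -!catA.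
- by have := weq_rel (p ++ u) (v ++ q) h; rewrite -!catA.
Qed.

Lemma weq_cat u u' v v' : weq R u u' -> weq R v v' -> weq R (u ++ v) (u' ++ v').
Proof.
move=> hu hv; apply: (@weq_trans _ _ _ (u' ++ v)); first exact: (weq_ctx [::] v hu).
by have := weq_ctx u' [::] hv; rewrite !cats0.
Qed.

Lemma weq_winvr u : weq R (u ++ winv u) [::].
Proof.
elim/last_ind: u => [|u [b s] ih]; first exact: weq_refl.
rewrite -cats1 winv_cat -catA /=.
exact: weq_trans (weq_free R u (winv u) b s) ih.
Qed.

Lemma weq_winvl u : weq R (winv u ++ u) [::].
Proof. by have := weq_winvr (winv u); rewrite winvK. Qed.

Lemma weq_winv u v : weq R u v -> weq R (winv u) (winv v).
Proof.
move=> h; apply: (@weq_trans _ _ _ (winv u ++ (v ++ winv v))).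
  rewrite -[X in weq R X _]cats0.
  exact: weq_cat (weq_refl _ _) (weq_sym (weq_winvr v)).
rewrite catA -[X in weq R _ X]cat0s; apply: weq_cat; last exact: weq_refl.
exact: weq_trans (weq_cat (weq_refl _ _) (weq_sym h)) (weq_winvl u).
Qed.

(** [wordlen] is chosen by [epsilon], so a minimal length must be shown to exist; equality in the
    group is not assumed decidable, hence the classical descent on a length bound. *)
Lemma wordlenP g : is_wordlen R g (wordlen R g).
Proof.
apply: epsilon_spec.
have main n : (exists2 w, weq R w g & (size w <= n)%N) -> exists k, is_wordlen R g k.
  elim: n => [|n ih] [w hw hs].
    by exists 0%N; split=> //; exists w; split=> //; apply/eqP; rewrite -leqn0.
  case: (classic (exists2 w, weq R w g & (size w <= n)%N)) => [/ih //|nex].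
  have min w' : weq R w' g -> (n < size w')%N.
    by move=> hw'; rewrite ltnNge; apply/negP => hs'; apply: nex; exists w'.
  exists n.+1; split=> //; exists w; split=> //.
  by apply/eqP; rewrite eqn_leq hs min.
by apply: (main (size g)); exists g => //; exact: weq_refl.
Qed.

Lemma wordlen_le g w : weq R w g -> (wordlen R g <= size w)%N.
Proof. by case: (wordlenP g) => _; apply. Qed.

Lemma wordlen_ge g n :
  (forall w, weq R w g -> (n <= size w)%N) -> (n <= wordlen R g)%N.
Proof. by case: (wordlenP g) => -[w [<- hw]] _; apply. Qed.

Lemma wordlen_eq g w :
  weq R w g -> (forall w', weq R w' g -> (size w <= size w')%N) ->
  wordlen R g = size w.
Proof.
by move=> hw min; apply/eqP; rewrite eqn_leq wordlen_le // wordlen_ge.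
Qed.

Lemma word_dist_sym x y : word_dist R x y = word_dist R y x.
Proof.
suff le x' y' : (word_dist R x' y' <= word_dist R y' x')%N.
  by apply/eqP; rewrite eqn_leq !le.
apply: wordlen_ge => w hw; rewrite -(size_winv w); apply: wordlen_le.
by have := weq_winv hw; rewrite winv_cat winvK.
Qed.

End Words.

Lemma weq_mono (S : finType) (R R' : rels S) u v :
  (forall l r, R l r -> R' l r) -> weq R u v -> weq R' u v.
Proof.
move=> sub; elim=> {u v}.
- exact: weq_refl.
- by move=> u v _; exact: weq_sym.
- by move=> u v w _ h1 _ h2; exact: weq_trans h1 h2.
- exact: weq_free.
- by move=> u v l r /sub; exact: weq_rel.
Qed.

Lemma altS (S : finType) (s t : S) k : alt s t k.+1 = (false, s) :: alt t s k.
Proof.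
rewrite /alt /mkseq /= -[1%N]/(1 + 0)%N iotaDl -map_comp; congr (_ :: _).
by apply: eq_map => i /=; case: (odd i).
Qed.

Lemma alt_rcons (S : finType) (s t : S) k :
  alt s t k.+1 = rcons (alt s t k) (false, if odd k then t else s).
Proof. by rewrite /alt mkseqS. Qed.

Lemma coxeter_square (S : finType) (m : S -> S -> option nat) s :
  weq (coxeter_rel m) [:: (false, s); (false, s)] [::].
Proof.
by apply: (@weq_rel _ (coxeter_rel m) [::] [::] [:: _; _] [::]); right; exists s.
Qed.

Lemma coxeter_inv (S : finType) (m : S -> S -> option nat) s :
  weq (coxeter_rel m) [:: (false, s)] [:: (true, s)].
Proof.
apply: weq_trans (weq_sym (weq_free _ [:: (false, s)] [::] false s)) _.
exact: (weq_ctx [::] [:: (true, s)] (coxeter_square m s)).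
Qed.

(** * Free reduction and tree metrics *)

Section FreeReduction.
Variables (A : eqType) (inv : A -> A).
Hypothesis invK : involutive inv.
Implicit Types (x y X Y : seq A).

Definition push a y := if y is b :: y' then if b == inv a then y' else a :: y else [:: a].

Definition nf x := foldr push [::] x.

Definition reduced x := sorted (fun a b => b != inv a) x.

Definition formal_inv x := rev (map inv x).

Lemma push_reduced a y : reduced y -> reduced (push a y).
Proof.
case: y => //= b y h; case: ifPn => [_|nb]; first exact: path_sorted h.
by rewrite /= nb.
Qed.

Lemma foldr_push_reduced x y : reduced y -> reduced (foldr push y x).
Proof. by move=> hy; elim: x => //= a x; exact: push_reduced. Qed.

Lemma nf_reduced x : reduced (nf x).
Proof. exact: foldr_push_reduced. Qed.

(** If [inv a] cancels the head [a] of [y], the next letter is not [inv a] because [y] is reduced,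
    so pushing [a] restores the head. Thus the letters act on reduced words as a group. *)
Lemma pushK a y : reduced y -> push a (push (inv a) y) = y.
Proof.
case: y => [|b y] /=; first by rewrite eqxx.
rewrite invK; case: (eqVneq b a) => [->|nba] /=; last by rewrite eqxx.
by case: y => [|c y] //= /andP[/negbTE ->].
Qed.

Lemma size_push a y : (size (push a y) <= (size y).+1)%N.
Proof. by case: y => //= b y; case: ifP => //= _; rewrite ltnW. Qed.

Lemma size_nf x : (size (nf x) <= size x)%N.
Proof. by elim: x => //= a x ih; rewrite (leq_trans (size_push _ _)). Qed.

Lemma nf_cat x y : nf (x ++ y) = foldr push (nf y) x.
Proof. by rewrite /nf foldr_cat. Qed.

Lemma formal_inv_cons a x : formal_inv (a :: x) = rcons (formal_inv x) (inv a).
Proof. by rewrite /formal_inv /= rev_cons. Qed.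

Lemma foldr_push_inv_nf x Y : reduced Y ->
  foldr push Y (formal_inv x) = foldr push Y (formal_inv (nf x)).
Proof.
elim: x Y => [//|a x ih] Y hY.
rewrite formal_inv_cons foldr_rcons ih; last exact: push_reduced.
rewrite /= -/(nf x); case: (nf x) => [//|b z].
rewrite [push a (b :: z)](_ : _ = if b == inv a then z else [:: a, b & z]) //.
case: (eqVneq b (inv a)) => [->|_].
  by rewrite formal_inv_cons foldr_rcons invK pushK.
by rewrite [in RHS]formal_inv_cons foldr_rcons.
Qed.

Fixpoint lcp X Y := match X, Y with
  | a :: X', b :: Y' => if a == b then (lcp X' Y').+1 else 0%N
  | _, _ => 0%N end.

(** Letters of [X] cancel against the head of [Y] as long as the two words agree; after the first
    mismatch nothing cancels, as [X] is reduced. *)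
Lemma size_foldr_push_inv X Y : reduced X ->
  (size (foldr push Y (formal_inv X)) + (lcp X Y).*2 = size X + size Y)%N.
Proof.
elim: X Y => [|a X ih] Y hX; first by rewrite /= addn0.
have hX' : reduced X by apply: path_sorted hX.
rewrite formal_inv_cons foldr_rcons.
have far Z : lcp X (inv a :: Z) = 0%N.
  by case: X hX {ih hX'} => //= c X /andP[/negbTE ->].
case: Y => [|b Y].
  by have := ih [:: inv a] hX'; rewrite /= far addn1 !addn0.
rewrite /= invK; case: (eqVneq b a) => _.
  by rewrite doubleS !addnS ih.
by have := ih [:: inv a, b & Y] hX'; rewrite far /= addn0 => ->; rewrite !addnS.
Qed.

Lemma size_nf_quotient x y :
  (size (nf (formal_inv x ++ y)) + (lcp (nf x) (nf y)).*2
   = size (nf x) + size (nf y))%N.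
Proof.
rewrite nf_cat foldr_push_inv_nf ?size_foldr_push_inv //; exact: nf_reduced.
Qed.

(** * Common prefixes and the quadratic form of a tree *)

(** Nonempty prefixes stand for the edges on the path from the root of the tree to [X]. *)
Definition prefixes X := [seq take i X | i <- iota 1 (size X)].

Lemma mem_prefixes p X : (p \in prefixes X) = (p != [::]) && prefix p X.
Proof.
apply/mapP/andP => [[j]|[pn0 hp]].
  rewrite mem_iota add1n ltnS => /andP[j0 jX] ->.
  by rewrite prefix_take -size_eq0 size_takel // -lt0n.
exists (size p); last by apply/eqP; rewrite eq_sym -prefixE.
by rewrite mem_iota add1n ltnS lt0n size_eq0 pn0 size_prefix.
Qed.

Lemma count_common_prefixes X Y : count (fun p => prefix p Y) (prefixes X) = lcp X Y.
Proof.
rewrite /prefixes count_map.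
elim: X Y => [//|a X ih] [|b Y].
  rewrite (eq_in_count (a2 := pred0)) ?count_pred0 // => j.
  by rewrite mem_iota; case: j.
rewrite /= take0 prefix0s andbT; case: (eqVneq a b) => [->|nab] /=; last first.
  rewrite (iotaDl 1 1) count_map (eq_count (a2 := pred0)) ?count_pred0 //.
  by move=> i /=; rewrite (negbTE nab).
rewrite (iotaDl 1 1) count_map -ih add1n; congr _.+1.
by apply: eq_count => i /=; rewrite eqxx.
Qed.

Lemma prefixes_uniq X : uniq (prefixes X).
Proof.
rewrite map_inj_in_uniq ?iota_uniq // => i j.
rewrite !mem_iota !add1n !ltnS => /andP[_ hi] /andP[_ hj] h.
by rewrite -(size_takel hi) h size_takel.
Qed.

(* Haagerup's computation on a tree: modulo terms killed by [\sum_i lam i = 0],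
   the distance is [-2] times the number of common nonempty prefixes. *)
Lemma prefix_form_lt0 (C : numClosedFieldType) n (X : 'I_n -> seq A)
    (d : 'I_n -> 'I_n -> nat) (lam : 'I_n -> C) :
  injective X ->
  (forall i j, (d i j + (lcp (X i) (X j)).*2 = size (X i) + size (X j))%N) ->
  \sum_i lam i = 0 -> (exists i, lam i != 0) ->
  \sum_i \sum_j lam i * Num.conj (lam j) * (d i j)%:R < 0.
Proof.
move=> injX hd s0 [i0 hi0].
pose P := undup (flatten [seq prefixes (X i) | i <- enum 'I_n]).
pose L p := \sum_i lam i * (prefix p (X i))%:R.
have s0c : \sum_i Num.conj (lam i) = 0 by rewrite -rmorph_sum s0 rmorph0.
have memP i p : p \in prefixes (X i) -> p \in P.
  rewrite mem_undup => h; apply/flattenP; exists (prefixes (X i)) => //.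
  by apply: map_f; rewrite mem_enum.
have nilP : [::] \notin P.
  rewrite mem_undup; apply/flattenP => -[_ /mapP[i _ ->]].
  by rewrite mem_prefixes eqxx.
(* The common prefix length is an inner product of indicator vectors over [P], which makes the form
   a sum of squares. *)
have lcpE i j : (lcp (X i) (X j))%:R =
    \sum_(p <- P) (prefix p (X i))%:R * (prefix p (X j))%:R :> C.
  rewrite -count_common_prefixes -sum1_count natr_sum.
  under [RHS]eq_bigr do rewrite -natrM mulnb.
  rewrite (perm_big [seq p <- P | p \in prefixes (X i)]) /=; last first.
    apply: uniq_perm; rewrite ?prefixes_uniq ?filter_uniq ?undup_uniq //.
    by move=> p; rewrite mem_filter; case: (boolP (p \in prefixes _)) => // /memP ->.
  rewrite big_filter_cond big_mkcond /=; rewrite big_seq [RHS]big_seq.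
  apply: eq_bigr => p pP; rewrite mem_prefixes.
  have -> /= : p != [::] by apply: contraNneq nilP => <-.
  by case: (prefix p (X i)); case: (prefix p (X j)).
have E : \sum_i \sum_j lam i * Num.conj (lam j) * (d i j)%:R =
    - (2 * \sum_(p <- P) `|L p| ^+ 2).
  have dE i j : (d i j)%:R =
      (size (X i))%:R + (size (X j))%:R - 2 * (lcp (X i) (X j))%:R :> C.
    by rewrite -natrD -hd -mul2n natrD natrM addrK.
  transitivity (\sum_i \sum_j (lam i * (size (X i))%:R * Num.conj (lam j)
      + lam i * (Num.conj (lam j) * (size (X j))%:R)
      - 2 * \sum_(p <- P) (lam i * (prefix p (X i))%:R)
              * Num.conj (lam j * (prefix p (X j))%:R))).
    apply: eq_bigr => i _; apply: eq_bigr => j _; rewrite dE lcpE.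
    have -> : \sum_(p <- P) (lam i * (prefix p (X i))%:R)
              * Num.conj (lam j * (prefix p (X j))%:R) =
       lam i * Num.conj (lam j) *
       \sum_(p <- P) (prefix p (X i))%:R * (prefix p (X j))%:R.
      rewrite mulr_sumr; apply: eq_bigr => p _.
      by rewrite rmorphM rmorph_nat; ring.
    by ring.
  under eq_bigr => i _ do rewrite sumrB big_split /= -!mulr_sumr s0c mulr0 add0r.
  rewrite sumrB -mulr_suml s0 mul0r sub0r -mulr_sumr; congr (- (2 * _)).
  under eq_bigr => i _ do rewrite exchange_big.
  rewrite exchange_big; apply: eq_bigr => p _.
  rewrite normCK /L rmorph_sum mulr_suml; apply: eq_bigr => i _.
  by rewrite mulr_sumr.
have [i hi imax] : exists2 i, lam i != 0 &
    forall j, lam j != 0 -> (size (X j) <= size (X i))%N.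
  case: (@arg_maxnP _ i0 (fun i => lam i != 0) (fun i => size (X i)) hi0).
  by move=> i hi imax; exists i.
(* By maximality of its length, [X i] is a prefix of no other word with nonzero coefficient. *)
have Li : L (X i) = lam i.
  rewrite /L (bigD1 i) //= prefix_refl mulr1 big1 ?addr0 // => j nji.
  case: (boolP (prefix (X i) (X j))) => [hp|]; last by rewrite mulr0.
  case: (eqVneq (lam j) 0) => [->|/imax hs]; first by rewrite mul0r.
  case/prefixP: hp hs => z Xj; rewrite Xj size_cat -[leqRHS]addn0 leq_add2l.
  rewrite leqn0 size_eq0 => /eqP z0; case/negP: nji.
  by apply/eqP/injX; rewrite Xj z0 cats0.
(* [X i] is not empty, since [L [::]] is the total sum [0] whereas [L (X i) = lam i] is nonzero. *)
have iP : X i \in P.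
  apply: (memP i); rewrite mem_prefixes prefix_refl andbT.
  apply: contraNneq hi => Xi0; rewrite -Li Xi0 /L.
  by under eq_bigr do rewrite prefix0s mulr1; rewrite s0.
rewrite E oppr_lt0 mulr_gt0 ?ltr0n //.
rewrite (big_rem _ iP) /= ltr_pwDl ?sumr_ge0 // ?Li ?exprn_gt0 ?normr_gt0 //.
by move=> p _; rewrite exprn_ge0.
Qed.

End FreeReduction.

(* [A] is the alphabet of monoid generators of the group: signed letters for the
   free group, [S] itself for a free product of groups of order two. *)
Lemma CSND_of_free_reduction (S : finType) (R : rels S) (A : eqType)
    (inv : A -> A) (f : letter S -> A) (g : A -> letter S) :
  involutive inv -> cancel g f ->
  (forall l, weq R [:: g (f l)] [:: l]) ->
  (forall b s, f (~~ b, s) = inv (f (b, s))) ->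
  (forall l r Y, R l r -> reduced inv Y ->
     foldr (push inv) Y (map f l) = foldr (push inv) Y (map f r)) ->
  word_metric_CSND R.
Proof.
move=> invK gK fK finv hrel.
pose N (w : word S) := nf inv (map f w).
have weqN u v : weq R u v -> N u = N v.
  elim=> {u v} // [u v w _ -> _ -> //|u v b s|u v l r h]; rewrite /N !map_cat !nf_cat.
    by congr foldr; rewrite /= finv pushK //; exact: nf_reduced.
  by rewrite (hrel l r) //; exact: nf_reduced.
have cancel_pair a : weq R [:: g a; g (inv a)] [::].
  apply: (@weq_trans _ _ _ [:: g a; (~~ (g a).1, (g a).2)]); last first.
    by have := weq_free R [::] [::] (g a).1 (g a).2; rewrite -surjective_pairing.
  apply: (weq_cat (u := [:: g a]) (u' := [:: g a])); first exact: weq_refl.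
  have := fK (~~ (g a).1, (g a).2).
  by rewrite finv -surjective_pairing gK.
have nf_weq w : weq R (map g (N w)) w.
  elim: w => [|l w ih]; first exact: weq_refl.
  have step : weq R (g (f l) :: map g (N w)) (l :: w).
    by apply: (weq_cat (u := [:: _]) (u' := [:: _])).
  rewrite /N /= -/(nf _ _) -/(N w); case: (N w) step => [//|a y] step.
  rewrite /push; case: eqP => [Ea|_] //.
  apply: weq_trans step; rewrite Ea; apply: weq_sym.
  by have := weq_cat (cancel_pair (f l)) (weq_refl R (map g y)).
(* All representatives share one normal form, and reduction never lengthens a word, so the normal
   form is geodesic. *)
have lenE w : wordlen R w = size (N w).
  rewrite -(size_map g); apply: wordlen_eq => // w' /weqN <-.
  by rewrite size_map (leq_trans (size_nf _ _)) // size_map.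
move=> n x lam distinct; apply: (prefix_form_lt0 (X := fun i => N (x i))).
- move=> i j hN; case: (eqVneq i j) => // /distinct[].
  by apply: weq_trans (weq_sym (nf_weq _)) _; rewrite hN.
- move=> i j; rewrite /word_dist lenE /N map_cat.
  rewrite -(size_nf_quotient invK (map f (x i))); congr (size (nf _ (_ ++ _)) + _)%N.
  rewrite /winv /formal_inv map_rev -!map_comp; congr rev.
  by apply: eq_map => -[b s] /=; rewrite finv.
Qed.

Lemma free_artin_CSND (S : finType) (m : S -> S -> option nat) :
  all_infinite m -> word_metric_CSND (artin_rel m).
Proof.
move=> minf; apply: (@CSND_of_free_reduction _ _ (letter S)
    (fun l => (~~ l.1, l.2)) id id) => //.
- by case=> b s; rewrite /= negbK.
- by move=> l; exact: weq_refl.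
- by move=> l r Y [s [t [k [/minf -> [//]]]]].
Qed.

Lemma free_coxeter_CSND (S : finType) (m : S -> S -> option nat) :
  all_infinite m -> word_metric_CSND (coxeter_rel m).
Proof.
move=> minf; apply: (@CSND_of_free_reduction _ _ S id snd (pair false)) => //.
- by case=> -[] s; [exact: coxeter_inv|exact: weq_refl].
- move=> l r Y [[s [t [k [/minf -> [//]]]]]|[s [-> ->]]] hY /=.
  by rewrite (@pushK _ id).
Qed.

(** * Geodesics in Coxeter groups *)

Local Notation Rr := Rdefinitions.R.

Definition angle (k : nat) : Rr := PI / k%:R.

(** [U i = sin (i th) / sin th] with [th = PI / k]: Chebyshev values giving the coordinates of the
    dihedral roots. Symmetry comes from [k th = PI], positivity from [0 < i th < PI]. *)
Lemma dihedral_coefficients (k : nat) : (2 <= k)%N ->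
  exists U : nat -> Rr,
  [/\ [/\ U 0%N = 0, U 1%N = 1 & forall i, U i.+2 = 2 * cos (angle k) * U i.+1 - U i],
      forall i, (i <= k)%N -> U (k - i)%N = U i,
      forall i, (0 < i < k)%N -> 0 < U i &
      cos (angle k) ^+ 2 != 1].
Proof.
move=> k2; set th := angle k.
have sinD x y : sin (x + y)%R = sin x * cos y + cos x * sin y := sin_plus x y.
have sinB x y : sin (x - y)%R = sin x * cos y - cos x * sin y := sin_minus x y.
have k0 : 0 < k%:R :> Rr by rewrite ltr0n ltnW.
have kth : k%:R * th = PI by rewrite /th /angle mulrC divfK // gt_eqF.
have PI0 : 0 < PI :> Rr by apply/RltP; exact: PI_RGT_0.
have th0 : 0 < th by rewrite divr_gt0.
have pos i : (0 < i < k)%N -> 0 < sin (i%:R * th)%R.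
  move=> /andP[i0 ik]; apply/RltP/sin_gt_0; apply/RltP.
    by rewrite mulr_gt0 ?ltr0n.
  by rewrite -kth ltr_pM2r // ltr_nat.
have s0 : 0 < sin th by have := pos 1%N; rewrite mulr1n mul1r; apply.
have s0' : sin th != 0 by rewrite gt_eqF.
exists (fun i => sin (i%:R * th)%R / sin th); split.
- split=> [||i].
  + by rewrite [X in sin X]mul0r sin_0 mul0r.
  + by rewrite mulr1n mul1r divff.
  + have -> : i.+2%:R * th = i.+1%:R * th + th by rewrite -[i.+2]addn1 natrD mulrDl mul1r.
    have -> : i%:R * th = i.+1%:R * th - th by rewrite -[i.+1]addn1 natrD mulrDl mul1r addrK.
    by rewrite sinD sinB; field.
- move=> i ik; congr (_ / _).
  have -> : (k - i)%:R * th = PI - i%:R * th by rewrite -kth natrB // mulrBl.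
  exact: sin_PI_x.
- by move=> i /pos h; rewrite divr_gt0.
- apply: contra s0' => /eqP c1.
  have := sin2_cos2 th; rewrite /Rsqr RplusE !RmultE -!expr2 c1 => h.
  rewrite -sqrf_eq0.
  by apply/eqP; apply: (addIr (1 : Rr)); rewrite h add0r.
Qed.

(** * Reflections and the parity of wall crossings *)

Section RootSystem.
Variables (S : finType) (V : lmodType Rr) (al : S -> V) (b : S -> V -> Rr).
Hypothesis b_linear : forall s a u v, b s (a *: u + v) = a * b s u + b s v.
Hypothesis b_al : forall s, b s (al s) = 2.

Definition refl s v := v - b s v *: al s.

(** The sign of a letter is ignored because a reflection is its own inverse. *)
Definition act (w : word S) v := foldr (fun l => refl l.2) v w.

(* The roots [s_1 ... s_(i-1) al_(s_i)] of the hyperplanes crossed by a gallery. *)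
Fixpoint crossed (w : word S) : seq V :=
  if w is l :: w' then al l.2 :: map (refl l.2) (crossed w') else [::].

Definition up_to_sign (v r : V) := (r == v) || (r == - v).

Definition crossing_parity w v := odd (count (up_to_sign v) (crossed w)).

Lemma b0 s : b s 0 = 0.
Proof. by have := b_linear s (-1) 0 0; rewrite scaler0 addr0 mulN1r addNr. Qed.

Lemma bZ s a v : b s (a *: v) = a * b s v.
Proof. by rewrite -[a *: v]addr0 b_linear b0 addr0. Qed.

Lemma bD s u v : b s (u + v) = b s u + b s v.
Proof. by rewrite -[u]scale1r b_linear mul1r scale1r. Qed.

Lemma refl_lin s a u v : refl s (a *: u + v) = a *: refl s u + refl s v.
Proof.
rewrite /refl b_linear scalerDl scalerBr scalerA opprD !addrA; congr (_ - _).
by rewrite -!addrA; congr (_ + _); rewrite addrC.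
Qed.

Lemma refl_al s : refl s (al s) = - al s.
Proof. by rewrite /refl b_al scaler_nat mulr2n opprD addNKr. Qed.

Lemma act_lin w a u v : act w (a *: u + v) = a *: act w u + act w v.
Proof. by elim: w => //= l w ->; rewrite refl_lin. Qed.

Lemma act0 w : act w 0 = 0.
Proof. by have := act_lin w (-1) 0 0; rewrite scaler0 addr0 scaleN1r addNr. Qed.

Lemma actZ w a v : act w (a *: v) = a *: act w v.
Proof. by rewrite -[a *: v]addr0 act_lin act0 addr0. Qed.

Lemma actN w v : act w (- v) = - act w v.
Proof. by rewrite -scaleN1r actZ scaleN1r. Qed.

Lemma reflK s : involutive (refl s).
Proof.
move=> v; have := refl_lin s (- b s v) (al s) v.
rewrite refl_al !scaleNr scalerN opprK [- _ + v]addrC -/(refl s v) => ->.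
by rewrite addrC /refl subrK.
Qed.

Lemma act_cat u v x : act (u ++ v) x = act u (act v x).
Proof. by rewrite /act foldr_cat. Qed.

Lemma crossed_cat u v : crossed (u ++ v) = crossed u ++ map (act u) (crossed v).
Proof.
elim: u => /= [|l u ->]; first by rewrite map_id_in.
by rewrite map_cat -map_comp.
Qed.

Lemma size_crossed w : size (crossed w) = size w.
Proof. by elim: w => //= l w ih; rewrite size_map ih. Qed.

Lemma up_to_signN v r : up_to_sign v (- r) = up_to_sign v r.
Proof. by rewrite /up_to_sign eqr_oppLR eqr_opp orbC. Qed.

Lemma act_square u l l' v x : l.2 = l'.2 -> act (u ++ [:: l; l'] ++ v) x = act (u ++ v) x.
Proof. by move=> El; rewrite !act_cat /= El reflK. Qed.

(** The two letters cross the same wall back and forth, and their product acts trivially on the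
    roots crossed later. *)
Lemma crossing_parity_square u l l' v x : l.2 = l'.2 ->
  crossing_parity (u ++ [:: l; l'] ++ v) x = crossing_parity (u ++ v) x.
Proof.
move=> El; rewrite /crossing_parity !crossed_cat !map_cat !count_cat !oddD.
congr (_ (+) _); rewrite /= El refl_al actN up_to_signN addbF addbb addFb.
rewrite -map_comp; congr (odd (count _ _)).
by apply: eq_map => y /=; rewrite El reflK.
Qed.

(** * Roots of a finite dihedral subgroup *)

Section Dihedral.
Variables (c : Rr) (k : nat) (U : nat -> Rr).
Hypothesis U0 : U 0%N = 0.
Hypothesis U1 : U 1%N = 1.
Hypothesis US : forall i, U i.+2 = 2 * c * U i.+1 - U i.
Hypothesis k2 : (2 <= k)%N.
Hypothesis Usym : forall i, (i <= k)%N -> U (k - i)%N = U i.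
Hypothesis Upos : forall i, (0 < i < k)%N -> 0 < U i.
Hypothesis c1 : c ^+ 2 != 1.

Definition angled s t := b s (al t) = - (2 * c) /\ b t (al s) = - (2 * c).

(** With the sine values for [U], this is [al s] rotated by [i] times the angle towards [al t],
    which is reached at [i = k - 1]. *)
Definition droot s t i := U i.+1 *: al s + U i *: al t.

Lemma angledC s t : angled s t -> angled t s.
Proof. by case. Qed.

Lemma refl_droot s t i : angled s t -> refl s (droot t s i) = droot s t i.+1.
Proof.
case=> hb _; rewrite /refl /droot bD !bZ b_al hb US.
by rewrite -addrA -scalerBl addrC; congr (_ *: _ + _); ring.
Qed.

Lemma act_alt_next s t i : angled s t ->
  act (alt s t i) (al (if odd i then t else s)) = droot s t i.
Proof.
elim: i s t => [|i ih] s t hst; first by rewrite /= /droot U1 U0 scale1r scale0r addr0.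
by rewrite altS /= if_neg ih ?refl_droot //; exact: angledC.
Qed.

Lemma crossed_alt s t i : angled s t -> crossed (alt s t i) = mkseq (droot s t) i.
Proof.
move=> hst; elim: i => [//|i ih].
by rewrite alt_rcons -cats1 crossed_cat ih mkseqS -cats1 /= act_alt_next.
Qed.

(** The two sides of a braid relation run along opposite halves of the [2k]-cycle and cross the same
    walls in opposite order; on coordinates this is the symmetry of [U]. *)
Lemma crossed_braid s t : angled s t -> crossed (alt t s k) = rev (crossed (alt s t k)).
Proof.
move=> hst; rewrite !crossed_alt //; last exact: angledC.
apply: (@eq_from_nth _ 0); rewrite ?size_rev !size_mkseq // => i ik.
rewrite nth_rev ?size_mkseq // !nth_mkseq //; last by rewrite subnSK ?leq_subr.
by rewrite /droot subnSK // !Usym ?(ltnW ik) // addrC.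
Qed.

Lemma Uk : U k = 0.
Proof. by rewrite -U0 -(Usym (leq0n k)) subn0. Qed.

Lemma Ukp : U k.-1 = 1.
Proof. by rewrite -U1 -(@Usym 1) ?subn1 // ltnW. Qed.

Lemma UkS : U k.+1 = -1.
Proof.
have k0 := ltnW k2; rewrite -[k]prednK // US prednK // Uk Ukp; ring.
Qed.

(** The longest element of the dihedral group sends simple roots to negatives of simple roots; this
    lemma and the next determine it on their plane. *)
Lemma act_alt_k_next s t : angled s t ->
  act (alt s t k) (al (if odd k then t else s)) = - al s.
Proof.
by move=> hst; rewrite act_alt_next // /droot Uk UkS scaleN1r scale0r addr0.
Qed.

Lemma act_alt_k_last s t : angled s t ->
  act (alt s t k) (al (if odd k then s else t)) = - al t.
Proof.
move=> hst; have kE : k = k.-1.+1 by rewrite prednK // ltnW.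
rewrite kE alt_rcons -cats1 act_cat /= if_neg refl_al actN act_alt_next //.
by rewrite /droot -kE Uk Ukp scale1r scale0r add0r.
Qed.

Lemma act_alt_fixed s t i v : b s v = 0 -> b t v = 0 -> act (alt s t i) v = v.
Proof.
elim: i s t => [//|i ih] s t hs ht; rewrite altS /= ih //.
by rewrite /refl hs scale0r subr0.
Qed.

(* [c ^+ 2 != 1] makes the form nondegenerate on the plane of [al s] and [al t],
   so that [v] splits into a part in that plane and a part fixed by both reflections. *)
Lemma act_braid s t v : angled s t -> act (alt s t k) v = act (alt t s k) v.
Proof.
move=> hst; have hts := angledC hst; case: (hst) => bst bts.
have c1' : 1 - c ^+ 2 != 0 by rewrite subr_eq0 eq_sym.
(* [p] and [q] solve the linear system [b s v0 = b t v0 = 0], whose determinant is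
   [4 * (1 - c ^+ 2)]. *)
pose p := (b s v + c * b t v) / (2 * (1 - c ^+ 2)).
pose q := (b t v + c * b s v) / (2 * (1 - c ^+ 2)).
pose v0 := (- p) *: al s + ((- q) *: al t + v).
have vE : v = p *: al s + (q *: al t + v0).
  by rewrite /v0 !scaleNr [q *: _ + _]addrCA !addNKr.
have v0s : b s v0 = 0.
  by rewrite /v0 !b_linear b_al bst /p /q; field.
have v0t : b t v0 = 0.
  by rewrite /v0 !b_linear b_al bts /p /q; field.
move: v0 vE v0s v0t => v0 vE v0s v0t.
rewrite vE !act_lin (act_alt_fixed _ v0s v0t) (act_alt_fixed _ v0t v0s).
have := (act_alt_k_next hst, act_alt_k_last hst, act_alt_k_next hts, act_alt_k_last hts).
by case: (odd k) => -[[[-> ->] ->] ->].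
Qed.

(** Two consecutive values of [U] determine the index, by running the recursion backwards to
    [U 0 = 0]; nonnegative coordinates keep these roots apart from their negatives. *)
Lemma droots_uniq s t :
  (forall x y x' y', x *: al s + y *: al t = x' *: al s + y' *: al t ->
     x = x' /\ y = y') ->
  uniq (mkseq (droot s t) k ++ map -%R (mkseq (droot s t) k)).
Proof.
move=> free_st; set D := mkseq _ _.
have back i j : (i <= j < k)%N -> U i = U j -> U i.+1 = U j.+1 -> i = j.
  elim: i j => [|i ih] [//|j] ijk hi hi1.
    by have := @Upos j.+1; rewrite -hi U0 ltxx; case: (j.+1 < k)%N ijk => // _ /(_ isT).
  congr _.+1; apply: ih => //; first by case/andP: ijk => ij /ltnW ->; rewrite andbT.
  by move: hi1; rewrite !US hi => /addrI /oppr_inj.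
have Unneg i : (i <= k)%N -> 0 <= U i.
  case: i => [|i]; first by rewrite U0.
  by rewrite leq_eqVlt => /predU1P[->|ik]; [rewrite Uk|apply/ltW/Upos].
have injD i j : (i < k)%N -> (j < k)%N -> droot s t i = droot s t j -> i = j.
  move=> ik jk /free_st[h1 h0].
  by case/orP: (leq_total i j) => ij; [|symmetry]; apply: back => //; rewrite ij.
have D_N i j : (i < k)%N -> (j < k)%N -> droot s t i <> - droot s t j.
  move=> ik jk; rewrite /droot opprD -!scaleNr => /free_st[h1 h0].
  have [i1 j1 i0 j0] : [/\ 0 <= U i.+1, 0 <= U j.+1, 0 <= U i & 0 <= U j].
    by split; apply: Unneg => //; exact: ltnW.
  have Ui0 : U i = 0 by apply/eqP; rewrite eq_le i0 andbT h0 oppr_le0.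
  have Ui1 : U i.+1 = 0 by apply/eqP; rewrite eq_le i1 andbT h1 oppr_le0.
  case: i {h1 h0 i1 i0} ik Ui0 Ui1 => [|i] ik Ui0 Ui1.
    by move/eqP: Ui1; rewrite U1 oner_eq0.
  by have := Upos (i := i.+1); rewrite ik Ui0 ltxx => /(_ isT).
have uD : uniq D.
  by rewrite map_inj_in_uniq ?iota_uniq // => i j; rewrite !mem_iota !add0n; exact: injD.
rewrite cat_uniq uD map_inj_uniq ?uD ?andbT /=; last exact: oppr_inj.
apply/hasPn => _ /mapP[_ /mapP[j jk ->] ->]; apply/mapP => -[i ik /esym].
by move: ik jk; rewrite !mem_iota !add0n => ik jk; exact: D_N.
Qed.

End Dihedral.

(** * Invariants of elements of the Coxeter group *)

Section Coxeter.
Variable m : S -> S -> option nat.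
Hypothesis mC : coxeter_matrix m.
Hypothesis b_m : forall s t k, s != t -> m s t = Some k ->
  b s (al t) = - (2 * cos (angle k)).

Lemma angled_m s t k : s != t -> m s t = Some k -> angled (cos (angle k)) s t.
Proof.
by move=> st mst; split; apply: b_m => //; rewrite 1?eq_sym // -(proj1 mC).
Qed.

(** A cancelled pair crosses one wall twice; a braid relation only reverses a block of crossings,
    and its two sides act alike, so the walls crossed afterwards stay in place. *)
Lemma weq_coxeter_invariants u v : weq (coxeter_rel m) u v ->
  act u =1 act v /\ crossing_parity u =1 crossing_parity v.
Proof.
elim=> {u v} //.
- by move=> u v _ [ha hp]; split=> x; rewrite ?ha ?hp.
- by move=> u v w _ [h1 h2] _ [h3 h4]; split=> x; rewrite ?h1 ?h3 ?h2 ?h4.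
- by move=> u v e s; split=> x; [exact: act_square|exact: crossing_parity_square].
move=> u v _ _ [[s [t [k [st [mst [-> ->]]]]]]|[s [-> ->]]]; last first.
  by split=> x; [exact: act_square|exact: crossing_parity_square].
have k2 := proj2 mC _ _ _ st mst; have hst := angled_m st mst.
case: (dihedral_coefficients k2) => U [[U0 U1 US] Usym Upos c1].
have braid := act_braid U0 U1 US k2 Usym c1 _ hst.
split=> x; first by rewrite !act_cat braid.
rewrite /crossing_parity !crossed_cat (crossed_braid U0 U1 US Usym hst).
rewrite !map_cat map_rev !count_cat count_rev; congr (odd (_ + (_ + count _ _))).
by rewrite -!map_comp; apply: eq_map => y /=; rewrite braid.
Qed.

(** The alternating word crosses each of its [k] roots exactly once, an odd number, so every other
    representative crosses each of them at least once. *)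
Lemma alt_geodesic_of_roots s t k w :
  (forall x y x' y', x *: al s + y *: al t = x' *: al s + y' *: al t ->
     x = x' /\ y = y') ->
  s != t -> m s t = Some k -> weq (coxeter_rel m) w (alt s t k) -> (k <= size w)%N.
Proof.
move=> free_st st mst /weq_coxeter_invariants[_ hp].
have k2 := proj2 mC _ _ _ st mst; have hst := angled_m st mst.
case: (dihedral_coefficients k2) => U [[U0 U1 US] Usym Upos c1].
set D := mkseq (droot U s t) k.
have uD : uniq (D ++ map -%R D).
  exact: (droots_uniq U0 U1 US Usym Upos free_st).
have in_w r : r \in D -> has (up_to_sign r) (crossed w).
  move=> rD; rewrite has_count.
  suff : crossing_parity w r by rewrite /crossing_parity; case: count.
  rewrite hp /crossing_parity (crossed_alt U0 U1 US) // -/D.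
  rewrite (eq_in_count (a2 := pred1 r)); last first.
    move=> x xD; rewrite /up_to_sign /=; case: eqP => //= _; apply/negP => /eqP xN.
    move: uD; rewrite cat_uniq => /and3P[_ /hasP[]]; exists x => //.
    by rewrite xN map_f.
  by rewrite count_uniq_mem ?rD //; move: uD; rewrite cat_uniq => /andP[].
(* Adjoining negatives turns distinctness up to sign into plain distinctness and yields
   [2k <= 2 * size w]. *)
have sub : {subset D ++ map -%R D <= crossed w ++ map -%R (crossed w)}.
  have subD r : r \in D -> (r \in crossed w) || (- r \in crossed w).
    by move/in_w/hasP => [x xw /orP[]/eqP <-]; rewrite xw ?orbT.
  move=> r; rewrite !mem_cat => /orP[/subD|/mapP[x /subD xw ->]].
    by case/orP=> [->//|/(map_f -%R)]; rewrite opprK => ->; rewrite orbT.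
  by rewrite (mem_map oppr_inj) orbC.
have := uniq_leq_size uD sub; rewrite !size_cat !size_map !size_crossed size_iota.
lia.
Qed.

End Coxeter.
End RootSystem.

Lemma alt_geodesic (S : finType) (m : S -> S -> option nat) s t k w :
  coxeter_matrix m -> s != t -> m s t = Some k ->
  weq (coxeter_rel m) w (alt s t k) -> (k <= size w)%N.
Proof.
move=> mC st mst.
pose V := {ffun S -> Rr^o}.
pose al s : V := [ffun u => (u == s)%:R].
(* Twice the standard Coxeter form on the space with basis [S], with [0] instead of the customary
   [-2] at an infinite coefficient. *)
pose B u s : Rr := if u == s then 2 else
  if m s u is Some k then - (2 * cos (angle k)) else 0.
pose b s (v : V) : Rr := \sum_u v u * B u s.
have b_al' x y : b x (al y) = B y x.
  rewrite /b (bigD1 y) //= ffunE eqxx mul1r big1 ?addr0 // => u /negbTE uy.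
  by rewrite ffunE uy mul0r.
apply: (@alt_geodesic_of_roots S V al b) => //.
- move=> x a u v; rewrite /b mulr_sumr -big_split; apply: eq_bigr => y _.
  by rewrite !ffunE mulrDl mulrA.
- by move=> x; rewrite b_al' /B eqxx.
- by move=> x y l xy mxy; rewrite b_al' /B eq_sym (negbTE xy) mxy.
move=> x y x' y' /ffunP h; have := (h s, h t).
rewrite !ffunE !eqxx [t == s]eq_sym (negbTE st) !scaler0 !addr0 !add0r.
by case; rewrite /GRing.scale /= !mulr1.
Qed.

(** * Antipodes of a dihedral cycle *)

(** Alternating signs give weight [+2] to the two diagonals of the square and [-2] to its four
    sides; the terms [d i i] are nonnegative. *)
Lemma alternating_square (C : numClosedFieldType) (d : nat -> nat -> nat) :
  (forall i j, d i j = d j i) ->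
  (d 0%N 1%N + d 1%N 2%N + d 2%N 3%N + d 0%N 3%N <= d 0%N 2%N + d 1%N 3%N)%N ->
  0 <= \sum_(i < 4) \sum_(j < 4) (-1) ^+ i * Num.conj ((-1) ^+ j) * (d i j)%:R :> C.
Proof.
move=> dC hd.
under eq_bigr do under eq_bigr do rewrite rmorphXn rmorphN1.
rewrite !big_ord_recl !big_ord0 /= /bump /= !add1n.
rewrite (dC 1%N 0%N) (dC 2 0)%N (dC 3 0)%N (dC 2 1)%N (dC 3 1)%N (dC 3 2)%N.
pose P := (d 0 0 + d 1 1 + d 2 2 + d 3 3 + 2 * (d 0 2 + d 1 3))%N.
pose Q := (2 * (d 0 1 + d 1 2 + d 2 3 + d 0 3))%N.
rewrite [leRHS](_ : _ = P%:R - Q%:R); last by rewrite /P /Q !(natrD, natrM); ring.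
rewrite subr_ge0 ler_nat /P /Q; lia.
Qed.

(* [x 0 = 1] and [x 2 = stst...] are antipodes of the dihedral [2k]-cycle, and so are
   their neighbours [x 1 = s] and [x 3]. *)
Lemma not_CSND_of_finite_coefficient (S : finType) (m : S -> S -> option nat)
    (R : rels S) s t k :
  coxeter_matrix m ->
  (forall l r, artin_rel m l r -> R l r) ->
  (forall l r, R l r -> coxeter_rel m l r) ->
  s != t -> m s t = Some k -> ~ word_metric_CSND R.
Proof.
move=> mC artinR Rcox st mst csnd.
have k2 := proj2 mC _ _ _ st mst.
(* From here the coefficient is [k.+1]: the sides of the square are at most [1, k, 1, k] and both
   diagonals at least [k.+1]. *)
case: k => [//|k] in k2 mst *.
have long w : weq (coxeter_rel m) w (alt s t k.+1) -> (k < size w)%N.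
  exact: alt_geodesic.
have braid : weq R (alt s t k.+1) (alt t s k.+1).
  have h : R (alt s t k.+1) (alt t s k.+1) by apply: artinR; exists s, t, k.+1.
  by have := weq_rel [::] [::] h; rewrite !cats0.
have size_alt x y n : size (alt x y n : word S) = n by rewrite size_mkseq.
pose xs := [:: [::]; [:: (false, s)]; alt s t k.+1; alt t s k] : seq (word S).
pose x i := nth [::] xs i.
have s_x3 w : weq (coxeter_rel m) w (alt t s k) ->
    weq (coxeter_rel m) ((false, s) :: w) (alt s t k.+1).
  by move=> h; rewrite altS; apply: (weq_cat (u := [:: _]) (u' := [:: _])) h; exact: weq_refl.
(* Any coincidence would give the alternating word of length [k.+1] a representative of length at
   most [k]. *)
have distinct i j : (i < j < 4)%N -> ~ weq R (x i) (x j).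
  move=> ij /(weq_mono Rcox) h.
  have sizes w : weq (coxeter_rel m) w (alt s t k.+1) -> (size w <= k)%N -> False.
    by move=> /long; lia.
  case: i j ij h => [|[|[|i]]] [|[|[|[|j]]]] //= ij h; try by move: ij; lia.
  - apply: (sizes (alt t s k)); rewrite ?size_alt // altS.
    by have := weq_ctx [::] (alt t s k) h.
  - exact: sizes h _.
  - exact: sizes (s_x3 _ h) _.
  - exact: sizes h _.
  - by apply: (sizes [::]) => //; apply: weq_trans (weq_sym (coxeter_square m s)) (s_x3 _ h).
  - by apply: sizes (weq_sym h) _; rewrite size_alt.
have sum0 : \sum_(i < 4) (-1) ^+ i = 0 :> Cx.
  by rewrite !big_ord_recl big_ord0 /= /bump /=; ring.
have distinct' (i j : 'I_4) : i != j -> ~ weq R (x i) (x j).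
  by rewrite neq_ltn => /orP[] ij; last move/weq_sym; apply: distinct; rewrite ij ltn_ord.
have : \sum_(i < 4) \sum_(j < 4) (-1) ^+ i * Num.conj ((-1) ^+ j)
    * (word_dist R (x i) (x j))%:R < 0 :> Cx.
  apply: (csnd 4 (fun i => x i) (fun i => (-1) ^+ i)) => //.
  by exists ord0; rewrite expr0 oner_eq0.
rewrite le_gtF //; apply: (@alternating_square _ (fun i j => word_dist R (x i) (x j))).
  by move=> i j; exact: word_dist_sym.
have d01 : (word_dist R (x 0%N) (x 1%N) <= 1)%N.
  by apply: (wordlen_le (w := [:: (false, s)])); exact: weq_refl.
have d03 : (word_dist R (x 0%N) (x 3%N) <= k)%N.
  by rewrite -(size_alt t s k); apply: wordlen_le; exact: weq_refl.
have d12 : (word_dist R (x 1%N) (x 2%N) <= k)%N.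
  rewrite -(size_alt t s k); apply: wordlen_le.
  by rewrite /x /= altS; exact: weq_sym (weq_free R [::] (alt t s k) true s).
have d23 : (word_dist R (x 2%N) (x 3%N) <= 1)%N.
  (* The braid relation rewrites [x 2] so that it begins with [t]; then it is [x 3] followed by the
     single letter [r]. *)
  set r := (false, if odd k then s else t).
  apply: (wordlen_le (w := winv [:: r])); apply: weq_sym.
  apply: (@weq_trans _ _ _ (winv (alt t s k.+1) ++ alt t s k)).
    by apply: weq_cat (weq_refl _ _); exact: weq_winv.
  rewrite alt_rcons -/r -cats1 winv_cat -catA -[X in weq _ _ X]cats0.
  exact: weq_cat (weq_refl _ _) (weq_winvl R _).
have d02 : (k < word_dist R (x 0%N) (x 2%N))%N.
  by apply: wordlen_ge => w /(weq_mono Rcox)/long.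
(* In the Coxeter quotient [s^-1] equals [s], so the quotient of [x 1] and [x 3] becomes the
   geodesic alternating word. *)
have d13 : (k < word_dist R (x 1%N) (x 3%N))%N.
  apply: wordlen_ge => w /(weq_mono Rcox) h; apply: long; apply: weq_trans h _.
  by rewrite altS; apply: weq_sym (weq_ctx [::] (alt t s k) (coxeter_inv m s)).
lia.
Qed.

Theorem theorem2 (S : finType) (m : S -> S -> option nat) :
  coxeter_matrix m ->
  (word_metric_CSND (coxeter_rel m) <-> all_infinite m) /\
  (word_metric_CSND (artin_rel m) <-> all_infinite m).
Proof.
move=> mC.
(* One argument serves both groups: [R] is any set of relations between the Artin and the Coxeter
   ones. *)
have nec (R : rels S) : (forall l r, artin_rel m l r -> R l r) ->
    (forall l r, R l r -> coxeter_rel m l r) -> word_metric_CSND R -> all_infinite m.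
  move=> h1 h2 csnd s t st; case mst: (m s t) => [k|//].
  by case: (not_CSND_of_finite_coefficient mC h1 h2 st mst).
split; split.
- by apply: nec => // l r; left.
- exact: free_coxeter_CSND.
- by apply: nec => // l r; left.
- exact: free_artin_CSND.
Qed.
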